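(* For every $p>0$ with $p\notin2\mathbb N$, there is a finite number $B(p)$ such that, in every dimension $d\ge2$, for every $\mu\in\mathcal M_p$ (on $\mathbb S^{d-1}$), the set $\operatorname{supp}\mu$ meets each great circle of $\mathbb S^{d-1}$ in at most $B(p)$ points. If $p=m$ is an odd integer, one may take $B(p)=10m$. If $p$ is not an integer, there is $\delta(p)>0$ such that one may take $$B(p)=(\lfloor p\rfloor+2)\left\lceil\frac{2\pi}{\delta(p)}\right\rceil.$$ In particular, every such minimizer on $\mathbb S^1$ has finite support.
   Context: $\mathbb S^{d-1}$ is the real unit sphere in $\mathbb R^d$. For $p>0$, $\mathcal M_p$ is the set of Borel probability measures on $\mathbb S^{d-1}$ minimizing $I_p(\mu)=\iint|x\cdot y|^p\,d\mu(x)\,d\mu(y)$ among all Borel probability measures on $\mathbb S^{d-1}$. $2\mathbb N$ is the set of positive even integers. A great circle is the intersection of $\mathbb S^{d-1}$ with a two-dimensional linear subspace. The numbers $B(p)$ and $\delta(p)$ depend only on $p$, not on $d$, the minimizer, or the circle. *)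

(* Defs.v *)
From HB Require Import structures.
From mathcomp Require Import all_boot all_order all_algebra.
From mathcomp Require Import all_classical all_reals all_analysis.

Set Implicit Arguments.
Unset Strict Implicit.
Unset Printing Implicit Defensive.

Import Order.TTheory GRing.Theory Num.Theory.
Import numFieldNormedType.Exports.

Local Open Scope classical_set_scope.
Local Open Scope ring_scope.

Definition dotr (R : realType) (d : nat) (x y : 'rV[R]_d) : R :=
  \sum_(i < d) x 0 i * y 0 i.

(* [usphere R n] is the unit sphere of R^(n+1), so S^(d-1) is
   [usphere R n] with d = n.+1.  The Euclidean norm is written out through
   [dotr] because the library norm on row vectors is the sup norm; the
   topology is the same for both. *)
Definition usphere_set (R : realType) (n : nat) : set 'rV[R]_n.+1 :=
  [set x | dotr x x = 1].

Arguments usphere_set : clear implicits.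

Definition usphere (R : realType) (n : nat) : Type :=
  set_type (usphere_set R n).

Lemma usphere_set_delta (R : realType) (n : nat) :
  (delta_mx 0 0 : 'rV[R]_n.+1) \in usphere_set R n.
Proof.
rewrite inE /usphere_set /= /dotr big_ord_recl !mxE !eqxx /= mulr1.
rewrite big1 ?addr0// => i _.
by rewrite mxE /= mul0r.
Qed.

Section usphere_structures.
Variables (R : realType) (n : nat).

HB.instance Definition _ :=
  Topological.copy (usphere R n) (set_type (usphere_set R n)).

(* The library requires measurable types to be pointed; the choice of the
   point plays no role. *)
HB.instance Definition _ :=
  isPointed.Build (usphere R n) (SigSub (usphere_set_delta R n)).

(* Borel sigma-algebra of the subspace topology. *)
HB.instance Definition _ :=
  Measurable.copy (usphere R n) (g_sigma_algebraType (@open (usphere R n))).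

End usphere_structures.

Definition udot (R : realType) (n : nat) (x y : usphere R n) : R :=
  dotr (set_val x) (set_val y).

Definition energy (R : realType) (n : nat) (p : R)
    (mu : probability (usphere R n) R) : \bar R :=
  (\int[mu]_x \int[mu]_y (`|udot x y| `^ p)%:E)%E.

Definition minimizer (R : realType) (n : nat) (p : R)
    (mu : probability (usphere R n) R) : Prop :=
  forall nu : probability (usphere R n) R, (energy p mu <= energy p nu)%E.

Definition supp (R : realType) (n : nat)
    (mu : probability (usphere R n) R) : set (usphere R n) :=
  [set x | forall U : set (usphere R n), open U -> U x -> (0 < mu U)%E].

Definition great_circle (R : realType) (n : nat)
    (C : set (usphere R n)) : Prop :=
  exists V : {vspace 'rV[R]_n.+1},
    \dim V = 2%N /\ C = [set x | set_val x \in V].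

Definition positive_even (R : realType) (p : R) : Prop :=
  exists k : nat, (0 < k)%N /\ p = (2 * k)%:R.

(* [B] is a valid bound for [p], uniformly over the dimension d = n.+1 >= 2,
   the minimizer and the great circle. *)
Definition circle_bound (R : realType) (p : R) (B : nat) : Prop :=
  forall n : nat, (2 <= n.+1)%N ->
  forall mu : probability (usphere R n) R, minimizer p mu ->
  forall C : set (usphere R n), great_circle C ->
    (supp mu `&` C #<= `I_B)%card.

(* Main.v *)
(** Perturbing a minimizer mu by a density 1 + t h with mean zero h, for both
    signs of t, makes the first-order term of the energy vanish and the
    second-order term nonnegative.  Concentrating h near points of the support
    shows that the kernel |x.y|^p minus the constant I_p(mu) > 0 is positive
    semidefinite on supp mu:
      (sum_i c_i)^2 I_p(mu) <= sum_(i,j) c_i c_j |x_i.x_j|^p.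
    On a great circle, points with coordinates (a_i, b_i), a_i > 0, and slopes
    t_i = b_i / a_i turn the kernel into (1 + t_i t_j)^p up to the factors
    a_i^p a_j^p.  Take for c_i the weights of the divided difference at the
    t_i, rescaled by a_i^-p.

    For p not an integer, the form is an N-fold divided difference in both
    variables, so for slopes near 0 it has the sign of binomial(p, N), which is
    negative for N = floor(p) + 2; hence a short arc holds at most
    floor(p) + 2 points.

    For p = m odd, with m + 2 slopes t_i >= 0, the form vanishes, since
    (1 + s t)^m has degree m in t; so sum_i c_i = 0.  But this sum is the
    divided difference of (1 + t^2)^(m/2), whose (m+1)-st derivative is a
    positive constant times (1 + t^2)^(-(m+2)/2).  Hence each of the four
    quadrants of the circle holds at most m + 1 points, and
    4 (m + 1) <= 10 m. *)
Require Import Defs.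
From mathcomp Require Import all_boot all_order all_algebra.
From mathcomp Require Import all_classical all_reals all_analysis.
From mathcomp Require Import measurable_realfun zify ring lra.

Set Implicit Arguments.
Unset Strict Implicit.
Unset Printing Implicit Defensive.

Import Order.TTheory GRing.Theory Num.Theory.
Import numFieldNormedType.Exports.

Local Open Scope classical_set_scope.
Local Open Scope ring_scope.

(** * Rolle's theorem and divided differences *)

(** Rolle is applied between consecutive zeros. The order statement starts at [x] so that the
    induction can prepend its new point: that point lies below [y], and [y] lies below every point
    found in the tail. *)
Lemma rolle_zeros (R : realType) (D : set R) (f g : R -> R) (x : R) (s : seq R) :
  is_interval D -> (forall y, D y -> is_derive y 1 f (g y)) ->
  path <%R x s -> (forall y, y \in x :: s -> D y /\ f y = 0) ->
  exists s', [/\ size s' = size s, path <%R x s' &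
    forall y, y \in s' -> D y /\ g y = 0].
Proof.
move=> iD fg; elim: s x => [|y s IH] x; first by exists [::].
move=> /= /andP[xy ys] z0.
have [|s' [ss ps zs]] := IH y ys.
  by move=> z zs; apply: z0; rewrite inE zs orbT.
have [Dx fx] : D x /\ f x = 0 by apply: z0; rewrite mem_head.
have [Dy fy] : D y /\ f y = 0 by apply: z0; rewrite !inE eqxx orbT.
have Dz z : x <= z <= y -> D z by exact: iD.
have [| | |c cxy dc] := @Rolle R f x y xy.
- move=> z /[!in_itv]/= /andP[xz zy].
  by apply: (@ex_derive _ _ _ _ _ _ _ (fg z _)); apply: Dz; rewrite !ltW.
- apply: derivable_within_continuous => z /[!in_itv]/= zxy.
  by apply: (@ex_derive _ _ _ _ _ _ _ (fg z _)); apply: Dz.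
- by rewrite fx fy.
have := cxy; rewrite in_itv/= => /andP[xc cy].
have Dc : D c by apply: Dz; rewrite !ltW.
exists (c :: s'); split => /=; first by rewrite ss.
- rewrite xc /=; case: s' ps {ss zs} => //= z s' /andP[yz ->].
  by rewrite (lt_trans cy yz).
- move=> z; rewrite inE => /predU1P[->|/zs//]; split => //.
  by have [_ <-] := fg c Dc; have [_ ->] := dc.
Qed.

Lemma iter_rolle (R : realType) (D : set R) (N : nat) (F : nat -> R -> R)
    (s : seq R) :
  is_interval D ->
  (forall k x, (k < N)%N -> D x -> is_derive x 1 (F k) (F k.+1 x)) ->
  size s = N.+1 -> sorted <%R s -> (forall x, x \in s -> D x /\ F 0 x = 0) ->
  exists xi, D xi /\ F N xi = 0.
Proof.
move=> iD; elim: N F s => [|N IH] F [//|x s] dF /= [ss] ps z0.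
  by exists x; apply: z0; rewrite mem_head.
have dF0 y : D y -> is_derive y 1 (F 0) (F 1 y) by exact: dF.
have [s' [ss' ps' zs']] := rolle_zeros iD dF0 ps z0.
apply: (IH (fun k => F k.+1) s') => //.
- by move=> k y kN; exact: dF.
- by rewrite ss' ss.
- exact: path_sorted ps'.
Qed.

(** These are the barycentric weights: [\sum_i dd_weight t i * f (t i)] is the divided difference of
    [f] at the nodes, i.e. the top coefficient of its Lagrange interpolant. *)
Definition dd_weight (R : fieldType) (N : nat) (t : 'I_N -> R) (i : 'I_N) : R :=
  (\prod_(j < N | j != i) (t i - t j))^-1.

Lemma derivn_size_le (R : comNzRingType) (p : {poly R}) (n : nat) :
  (size p <= n.+1)%N -> p^`(n) = (p`_n *+ n`!)%:P.
Proof.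
move=> sp; apply/polyP => i; rewrite coef_derivn coefC.
case: i => [|i] /=; first by rewrite addn0 ffactnn.
by rewrite nth_default ?mul0rn// (leq_trans sp)// addnS ltnS leq_addr.
Qed.

(** The Lagrange interpolant [P] of [F 0] has a constant derivative of order [N], equal to N! times
    the divided difference. The difference of [F 0] and [P] has [N + 1] zeros, so iterated Rolle
    gives a zero of its derivative of order [N]. *)
Lemma divided_difference_mean (R : realType) (D : set R) (N : nat)
    (t : 'I_N.+1 -> R) (F : nat -> R -> R) :
  is_interval D -> injective t -> (forall i, D (t i)) ->
  (forall k x, (k < N)%N -> D x -> is_derive x 1 (F k) (F k.+1 x)) ->
  exists xi, D xi /\ (\sum_i dd_weight t i * F 0 (t i)) *+ N`! = F N xi.
Proof.
move=> iD tinj Dt dF.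
pose L i : {poly R} := \prod_(j < N.+1 | j != i) ('X - (t j)%:P).
pose P := \sum_i (dd_weight t i * F 0 (t i)) *: L i.
have Lmonic i : L i \is monic by exact: monic_prod_XsubC.
have sL i : size (L i) = N.+1.
  rewrite /L -big_filter size_prod_XsubC; have [e _ _ [_ ->]] := big_enumP.
  by rewrite (cardC1 i) card_ord.
have Lt i k : i != k -> (L i).[t k] = 0.
  move=> ik; rewrite /L horner_prod (bigD1 k) 1?eq_sym//= !hornerE subrr.
  by rewrite mul0r.
have Pt i : P.[t i] = F 0 (t i).
  rewrite /P horner_sum (bigD1 i)//= big1 ?addr0; last first.
    by move=> k ki; rewrite hornerZ Lt// mulr0.
  rewrite hornerZ mulrAC /dd_weight /L horner_prod.
  under eq_bigr do rewrite !hornerE.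
  rewrite mulVf ?mul1r//; apply/prodf_neq0 => j ji.
  by rewrite subr_eq0 (inj_eq tinj) eq_sym.
have PN : P^`(N) = ((\sum_i dd_weight t i * F 0 (t i)) *+ N`!)%:P.
  rewrite derivn_size_le; last first.
    by apply: (leq_trans (size_sum _ _ _)); apply/bigmax_leqP => i _;
      rewrite (leq_trans (size_scale_leq _ _))// sL.
  rewrite /P coef_sum; congr (_ *+ _)%:P; apply: eq_bigr => i _.
  have := monicP (Lmonic i); rewrite /lead_coef sL /= coefZ => ->.
  by rewrite mulr1.
have [||||xi [Dxi Nxi]] := @iter_rolle R D N (fun k x => F k x - P^`(k).[x])
    (sort <=%R (map t (enum 'I_N.+1))) iD.
- move=> k x kN Dx; rewrite derivnS; have := dF k x kN Dx => ?.
  exact: is_deriveB.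
- by rewrite size_sort size_map size_enum_ord.
- by rewrite sort_lt_sorted map_inj_uniq// enum_uniq.
- move=> x; rewrite mem_sort => /mapP[i _ ->]; split => //.
  by rewrite derivn0 Pt subrr.
exists xi; split => //; move: Nxi; rewrite PN hornerC.
by move/eqP; rewrite subr_eq0 => /eqP.
Qed.

(** * Derivatives of powers of polynomials, in particular of (1 + x^2)^(m/2) *)

(** Differentiation preserves the form P w^r and lowers r by one. The explicit families of higher
    derivatives below all rest on this. *)
Lemma horner_powR_is_derive (R : realType) (w P : {poly R}) (r x : R) : 0 < w.[x] ->
  is_derive x 1 (fun y : R => P.[y] * w.[y] `^ r)
    ((w * P^`() + r *: (w^`() * P)).[x] * w.[x] `^ (r - 1)).
Proof.
move=> h.
have d2 := @is_derive1_powR R r w.[x] h.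
have d1 := is_derive_poly w x.
have d3 := (@is_derive1_comp R (fun y => y `^ r) (fun y => w.[y]) x _ _ d2 d1).
have d4 := is_deriveM (is_derive_poly P x) d3.
rewrite [X in is_derive _ _ _ X](_ : _ =
    P.[x] *: (r * w.[x] `^ (r - 1) * w^`().[x]) + w.[x] `^ r *: P^`().[x]).
  exact: d4.
rewrite /GRing.scale/= !hornerE /= .
have -> : w.[x] `^ r = w.[x] * w.[x] `^ (r - 1).
  rewrite -[X in X * _](@powRr1 R) ?(ltW h)// -powRD ?subrKC//.
  by rewrite (gt_eqF h) implybT.
ring.
Qed.

(* [powR_poly a k] is the polynomial P_k such that the k-th derivative of
   (1 + x^2)^(a/2) is P_k(x) (1 + x^2)^(a/2 - k). *)
Fixpoint powR_poly (R : realType) (a : R) (k : nat) : {poly R} :=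
  if k is k'.+1 then
    (1 + 'X^2) * (powR_poly a k')^`() +
      (a - 2 * k'%:R) *: ('X * powR_poly a k')
  else 1.

Lemma powR_polyS (R : realType) (a : R) (k : nat) :
  powR_poly a k.+1 = (1 + 'X^2) * (powR_poly a k)^`() +
    (a - 2 * k%:R) *: ('X * powR_poly a k).
Proof. by []. Qed.

Lemma powR_poly_is_derive (R : realType) (a : R) (k : nat) (x : R) :
  is_derive x 1
    (fun y : R => (powR_poly a k).[y] * (1 + y ^+ 2) `^ (a / 2 - k%:R))
    ((powR_poly a k.+1).[x] * (1 + x ^+ 2) `^ (a / 2 - k.+1%:R)).
Proof.
pose w : {poly R} := 1 + 'X^2.
have wE y : w.[y] = 1 + y ^+ 2 by rewrite /w !hornerE.
have w0 : 0 < w.[x] by rewrite wE ltr_wpDr ?sqr_ge0.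
have := @horner_powR_is_derive R w (powR_poly a k) (a / 2 - k%:R) x w0.
rewrite -[k.+1%:R]natr1 opprD addrA wE.
under [X in is_derive _ _ X]funext do rewrite wE.
move=> /is_derive_eq; apply; congr (_ * _) => /=.
rewrite /w !poly.derivE !hornerE /=; by field.
Qed.

(** This follows from the recursion by induction. Its purpose is the case [a = k = m], where the
    factor [a - k] vanishes and P_(m+1) becomes constant. *)
Lemma deriv_powR_poly (R : realType) (a : R) (k : nat) :
  (powR_poly a k.+1)^`() = (k.+1%:R * (a - k%:R)) *: powR_poly a k.
Proof.
elim: k => [|k IH].
  by rewrite /= derivC mulr0 add0r mulr1 linearZ/= derivX mulr0 !subr0 mul1r.
rewrite (powR_polyS a k.+1) IH derivD derivM !derivZ derivM derivX IH.
rewrite (powR_polyS a k).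
rewrite -!mul_polyC; move: (powR_poly a k) => p0.
rewrite -polyC1 derivD derivC derivXn /= -!natr1.
rewrite !(polyCM, polyCB, polyCD, polyC_natr).
ring.
Qed.

(** The polynomial is constant, so its value at 0 suffices. There P_(k+2)(0) = P_(k+1)'(0) =
    (k+1)(m-k) P_k(0), with a positive factor for k < m. Starting from P_0 = 1, steps of two reach m
    + 1 because m is odd. *)
Lemma powR_poly_odd_gt0 (R : realType) (m : nat) (x : R) : odd m ->
  0 < (powR_poly m%:R m.+1).[x].
Proof.
move=> om.
have cst : powR_poly (m%:R : R) m.+1 = ((powR_poly m%:R m.+1)`_0)%:P.
  apply/polyP => -[|i]; rewrite coefC//=.
  have : (powR_poly (m%:R : R) m.+1)^`()`_i = 0.
    by rewrite deriv_powR_poly subrr mulr0 scale0r coef0.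
  by rewrite coef_deriv => /eqP; rewrite mulrn_eq0 => /eqP.
have pos j : (j.*2 <= m.+1)%N -> 0 < (powR_poly (m%:R : R) j.*2).[0].
  elim: j => [_|j IH]; first by rewrite double0 hornerC.
  rewrite doubleS => jm.
  have -> : (powR_poly (m%:R : R) j.*2.+2).[0]
      = (powR_poly (m%:R : R) j.*2.+1)^`().[0].
    rewrite (powR_polyS _ j.*2.+1) hornerD hornerM hornerZ hornerM hornerX.
    by rewrite mul0r mulr0 addr0 hornerD hornerXn hornerC expr0n addr0 mul1r.
  rewrite deriv_powR_poly hornerZ mulr_gt0// ?IH//; last by rewrite ltnW// ltnW.
  by rewrite mulr_gt0// subr_gt0 ltr_nat.
have := pos m.+1./2; rewrite halfK /= om subn0 leqnn => /(_ isT).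
by rewrite -powR_polyS cst !hornerC.
Qed.

Lemma powR_divided_difference_gt0 (R : realType) (m : nat) (t : 'I_m.+2 -> R) :
  odd m -> injective t ->
  0 < \sum_i dd_weight t i * (1 + t i ^+ 2) `^ (m%:R / 2).
Proof.
move=> om tinj.
have iD : is_interval [set: R] by [].
have [//|k x _ _|xi [_]] := @divided_difference_mean R setT m.+1 t
  (fun k x => (powR_poly m%:R k).[x] * (1 + x ^+ 2) `^ (m%:R / 2 - k%:R)) iD tinj.
  exact: powR_poly_is_derive.
under eq_bigr do rewrite hornerC mul1r subr0.
rewrite -mulr_natr => e.
have : 0 < (m.+1)`!%:R :> R by rewrite ltr0n fact_gt0.
move=> f0; rewrite -(pmulr_lgt0 _ f0) e mulr_gt0 ?powR_poly_odd_gt0//.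
by rewrite powR_gt0 ?ltr_wpDr ?sqr_ge0.
Qed.

(** * Divided differences of (1 + s t)^p *)

Lemma divided_difference_poly (R : realType) (N : nat) (t : 'I_N.+1 -> R)
    (p : {poly R}) : injective t -> (size p <= N)%N ->
  \sum_i dd_weight t i * p.[t i] = 0.
Proof.
move=> tinj sp; have iD : is_interval [set: R] by [].
have [//|k x _ _|xi [_]] := @divided_difference_mean R setT N t
  (fun k x => p^`(k).[x]) iD tinj.
  by rewrite derivnS; exact: is_derive_poly.
rewrite derivn0 derivn_poly0// horner0 => /eqP; rewrite mulrn_eq0.
by rewrite eqn0Ngt fact_gt0 => /eqP.
Qed.

(* [euler_poly N q k] is the polynomial Q_k such that the k-th derivative in t of
   t^N (1 + s t)^q is t^(N-k) Q_k(s t) (1 + s t)^(q-k), for k <= N. *)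
Fixpoint euler_poly (R : realType) (N : nat) (q : R) (k : nat) : {poly R} :=
  if k is k'.+1 then
    (N - k')%:R *: ((1 + 'X) * euler_poly N q k')
    + 'X * ((1 + 'X) * (euler_poly N q k')^`()
            + (q - k'%:R) *: euler_poly N q k')
  else 1.

(** At 0 each step of the recursion only multiplies by [N - k']. By continuity the derivative of
    order [N] of t^N (1 + s t)^q is then positive for small s t. *)
Lemma euler_poly_at0 (R : realType) (N : nat) (q : R) (k : nat) :
  (k <= N)%N -> 0 < (euler_poly N q k).[0].
Proof.
elim: k => [|k IH] kN /=; first by rewrite hornerC.
rewrite hornerD hornerZ hornerM [X in _ + X]hornerM hornerX mul0r addr0.
rewrite hornerD hornerX hornerC addr0 mul1r mulr_gt0 ?IH ?(ltnW kN)//.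
by rewrite ltr0n subn_gt0.
Qed.

Lemma euler_poly_is_derive (R : realType) (N : nat) (q s : R) (k : nat) (x : R) :
  (k < N)%N -> 0 < 1 + s * x ->
  is_derive x 1
    (fun y : R => y ^+ (N - k) * (euler_poly N q k).[s * y]
                  * (1 + s * y) `^ (q - k%:R))
    (x ^+ (N - k.+1) * (euler_poly N q k.+1).[s * x]
     * (1 + s * x) `^ (q - k.+1%:R)).
Proof.
move=> kN h.
pose w : {poly R} := 1 + s *: 'X.
have wE y : w.[y] = 1 + s * y by rewrite /w !hornerE.
pose P := 'X^(N - k) * (euler_poly N q k \Po (s *: 'X)).
have PE y : P.[y] = y ^+ (N - k) * (euler_poly N q k).[s * y].
  by rewrite /P hornerM hornerXn horner_comp hornerZ hornerX.
have w0 : 0 < w.[x] by rewrite wE.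
have := @horner_powR_is_derive R w P (q - k%:R) x w0.
rewrite -[k.+1%:R]natr1 opprD addrA wE.
under [X in is_derive _ _ X]funext do rewrite wE PE.
move=> /is_derive_eq; apply; congr (_ * _).
rewrite /w /P [euler_poly _ _ k.+1]/= derivM deriv_comp derivXn derivD.
rewrite -polyC1 derivC derivZ derivX !(hornerD, hornerM, hornerZ, hornerMn).
rewrite !(hornerXn, horner_comp, hornerX, hornerC, hornerD, hornerM, hornerZ).
have -> : (N - k = (N - k.+1).+1)%N by rewrite subnSK.
rewrite [(_.+1).-1]/= exprS -[(N - k.+1).+1%:R]natr1 -[x ^+ _ *+ _]mulr_natr -natr1.
ring.
Qed.

(** Only the last factor, [p - n.+1%:R], is negative. *)
Lemma falling_lt0 (R : realType) (p : R) (n : nat) :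
  n%:R < p -> p < n.+1%:R -> \prod_(l < n.+2) (p - l%:R) < 0.
Proof.
move=> np pn; rewrite big_ord_recr /= nmulr_llt0 ?subr_lt0//.
apply: prodr_gt0 => i _; rewrite subr_gt0 (le_lt_trans _ np)// ler_nat.
by rewrite -ltnS.
Qed.

(** The mean value property is used twice. In s it yields the derivative of order N at some [xi],
    which is the falling factorial of p times the divided difference of t^N (1 + xi t)^(p-N). In t
    it turns the latter into Q_N(xi z) (1 + xi z)^(p-2N) up to N!, which is positive for small xi
    z. *)
Lemma powR_kernel_double_difference (R : realType) (p : R) (n : nat) :
  n%:R < p -> p < n.+1%:R ->
  exists2 eta : R, 0 < eta & forall t : 'I_n.+3 -> R, injective t ->
    (forall i, `|t i| < eta) ->
    \sum_i \sum_j dd_weight t i * dd_weight t j * (1 + t i * t j) `^ p < 0.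
Proof.
move=> np pn; pose N := n.+2; pose q := p - N%:R.
have /cvgrPdist_lt := @continuous_horner R (euler_poly N q N) 0.
have Q0 := euler_poly_at0 q (leqnn N).
move=> /(_ _ Q0) [e e0 He].
(* The bound [e] keeps Q_N positive; the bound 1 makes [D] stable under products, so that
   [1 + x * y] is positive on [D]. *)
exists (Num.min e 1); first by rewrite lt_min e0 ltr01.
move=> t tinj ht.
pose eta := Num.min e 1.
pose D := [set x : R | `|x| < eta].
have eta1 : eta <= 1 by rewrite /eta ge_min lexx orbT.
have iD : is_interval D.
  move=> x y; rewrite /D /= !ltr_norml => /andP[x1 x2] /andP[y1 y2] z /andP[xz zy].
  by rewrite ltr_norml (lt_le_trans x1 xz) (le_lt_trans zy y2).
have Dxy x y : D x -> D y -> `|x * y| < eta.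
  rewrite /D /= => Dx Dy; rewrite normrM.
  have [->|y0] := eqVneq y 0; first by rewrite normr0 mulr0 (le_lt_trans _ Dx).
  by rewrite (le_lt_trans _ Dy)// ler_piMl// (ltW (lt_le_trans Dx eta1)).
have pos x y : D x -> D y -> 0 < 1 + x * y.
  move=> Dx Dy; have := lt_le_trans (Dxy x y Dx Dy) eta1.
  by rewrite ltr_norml => /andP[+ _]; lra.
pose d := dd_weight t.
(* [F k] is the derivative of order [k] in s of the divided difference in t of (1 + s t)^p. *)
pose F k (s : R) := \sum_j (d j * (\prod_(l < k) (p - l%:R)) * t j ^+ k)
                     * (1 + t j * s) `^ (p - k%:R).
have dF k x : (k < N)%N -> D x -> is_derive x 1 (F k) (F k.+1 x).
  move=> _ Dx.
  have -> : F k = \sum_(j < N.+1) (fun s : R =>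
      (d j * (\prod_(l < k) (p - l%:R)) * t j ^+ k)
      * (1 + t j * s) `^ (p - k%:R)).
    by apply/funext => s; rewrite fct_sumE.
  apply: is_derive_sum => j.
  pose w : {poly R} := 1 + t j *: 'X.
  have wE y : w.[y] = 1 + t j * y by rewrite /w !hornerE.
  have w0 : 0 < w.[x] by rewrite wE; exact: (pos _ _ (ht j) Dx).
  have := @horner_powR_is_derive R w
    (d j * \prod_(l < k) (p - l%:R) * t j ^+ k)%:P (p - k%:R) x w0.
  rewrite -[k.+1%:R]natr1 opprD addrA wE.
  under [X in is_derive _ _ X]funext do rewrite wE hornerC.
  move=> /is_derive_eq; apply; congr (_ * _).
  rewrite /w derivC mulr0 add0r derivD -polyC1 derivC add0r derivZ derivX.
  rewrite !(hornerZ, hornerM, hornerC) big_ord_recr exprS /=; ring.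
have [xi [Dxi e1]] := divided_difference_mean iD tinj ht dF.
pose G k (y : R) := y ^+ (N - k) * (euler_poly N q k).[xi * y]
                  * (1 + xi * y) `^ (q - k%:R).
have dG k x : (k < N)%N -> D x -> is_derive x 1 (G k) (G k.+1 x).
  by move=> kN Dx; apply: euler_poly_is_derive => //; exact: pos.
have [z [Dz e2]] := divided_difference_mean iD tinj ht dG.
have f0 : 0 < (N`!)%:R :> R by rewrite ltr0n fact_gt0.
have GN : 0 < G N z.
  rewrite /G subnn expr0 mul1r mulr_gt0//; last by rewrite powR_gt0 ?pos.
  have xz : `|0 - xi * z| < e.
    by rewrite sub0r normrN (lt_le_trans (Dxy _ _ Dxi Dz))// /eta ge_min lexx.
  by have := He _ xz; rewrite ltr_norml => /andP[_]; rewrite ltrBlDr ltrDl.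
have FN : F N xi < 0.
  have -> : F N xi = \prod_(l < N) (p - l%:R) * \sum_i dd_weight t i * G 0 (t i).
    rewrite /F mulr_sumr; apply: eq_bigr => j _.
    by rewrite /G subn0 subr0 /= hornerC [t j * xi]mulrC /d /q; ring.
  rewrite nmulr_rlt0 ?falling_lt0//.
  by rewrite -(pmulr_lgt0 _ f0) mulr_natr e2.
have : \sum_i dd_weight t i * F 0 (t i) < 0.
  by rewrite -(pmulr_llt0 _ f0) mulr_natr e1.
congr (_ < _); apply: eq_bigr => i _.
rewrite /F mulr_sumr; apply: eq_bigr => j _.
by rewrite big_ord0 expr0 !mulr1 subr0 mulrA [t j * t i]mulrC.
Qed.

(** * Counting points by pigeonhole *)

(** If the bound failed, [A] would contain [k * #|F| + 1] distinct points, whether finite or not,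
    and [k + 1] of them would share a value of [f]. *)
Lemma card_le_fibers (T : pointedType) (F : finType) (A : set T) (f : T -> F)
    (k : nat) :
  (forall x : 'I_k.+1 -> T, injective x -> (forall i, A (x i)) ->
    (forall i j, f (x i) = f (x j)) -> False) ->
  (A #<= `I_(k * #|F|))%card.
Proof.
move=> noinj; pose B := (k * #|F|)%N.
have [//|nAB] := boolP (A #<= `I_B)%card.
have : (`I_B.+1 #<= A)%card.
  have [[n An]|/infiniteP] := pselect (finite_set A); last first.
    by apply: card_le_trans; exact: card_leT.
  rewrite (card_le_eqr An) card_le_II ltnNge; apply: contra nAB.
  by rewrite (card_le_eql An) card_le_II.
move=> /pcard_leP/unsquash g.
pose x (i : 'I_B.+1) := g i.
have xinj : injective x.
  by move=> i j /(@inj _ _ _ g) e; apply/val_inj/e; rewrite inE /=.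
have xA i : A (x i) by apply: (@funS _ _ _ _ g); rewrite /=.
have [v kv] : exists v, (k < #|[set i | f (x i) == v]%SET|)%N.
  apply/existsP; apply: contraT; rewrite negb_exists => /forallP small.
  suff : (B.+1 <= B)%N by rewrite ltnn.
  rewrite -{1}[B.+1]card_ord -sum1_card (partition_big (f \o x) predT)//=.
  rewrite [leqRHS](_ : _ = \sum_(v : F) k)%N; last by rewrite sum_nat_const mulnC.
  apply: leq_sum => v _.
  have := small v; rewrite -leqNgt => /(leq_trans _); apply.
  by rewrite sum1dep_card.
pose y (i : 'I_k.+1) := x (enum_val (widen_ord kv i)).
exfalso; apply: (noinj y) => [i j /xinj/enum_val_inj/(congr1 val)/= e|i|i j].
- exact: val_inj.
- exact: xA.
- have e l : f (y l) = v.
    by have := enum_valP (widen_ord kv l); rewrite inE => /eqP.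
  by rewrite !e.
Qed.

(** * First and second order conditions for a finite quadratic form *)

Lemma quadratic_ge0_near0 (R : realFieldType) (L Q b : R) : 0 < b ->
  (forall t, `|t| <= b -> 0 <= t * L + t ^+ 2 * Q) -> L = 0 /\ 0 <= Q.
Proof.
move=> b0 pert.
have small s : 0 < s -> s <= b -> `|L| <= s * Q.
  move=> s0 sB; have := pert s; have := pert (- s).
  rewrite normrN gtr0_norm// => /(_ sB) h1 /(_ sB) h2.
  by rewrite ler_norml -(ler_pM2l s0) -(ler_pM2l s0 L); apply/andP; split; lra.
have Q0 : 0 <= Q.
  by rewrite -(pmulr_rge0 _ b0) (le_trans _ (small _ b0 (lexx _))).
split=> //; apply/eqP; rewrite -normr_le0 leNgt; apply/negP => Lp.
(* With this choice [s * Q] is below [|L| / 2], against the bound [small]. *)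
pose s := Num.min b (`|L| / (2 * (Q + 1))).
have Qp : 0 < 2 * (Q + 1) by lra.
have s0 : 0 < s by rewrite lt_min b0 divr_gt0.
have sB : s <= b by rewrite ge_min lexx.
have s2 : s * (2 * (Q + 1)) <= `|L| by rewrite -ler_pdivlMr// ge_min lexx orbT.
by have := small s s0 sB; lra.
Qed.

(** In the application [m k] is the mass of the cell [k], [a k l] the energy between two cells, and
    [w] a density constant on cells. The first order condition reads S = 2 Z A; inserted into Q >= 0
    it gives the claim. *)
Lemma quadratic_form_minimum (R : realFieldType) (n : nat)
    (a : 'I_n -> 'I_n -> R) (m z : 'I_n -> R) :
  \sum_k m k = 1 ->
  (forall w, (forall k, 0 <= w k) -> \sum_k w k * m k = 1 ->
    \sum_k \sum_l a k l <= \sum_k \sum_l w k * w l * a k l) ->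
  (\sum_k z k * m k) ^+ 2 * (\sum_k \sum_l a k l) <=
    \sum_k \sum_l z k * z l * a k l.
Proof.
move=> m1 amin; set Z := \sum_k z k * m k; set A := \sum_k \sum_l a k l.
(* Subtracting the mean keeps the total mass of 1 + t h equal to 1. *)
pose h k := z k - Z.
have hm : \sum_k h k * m k = 0.
  under eq_bigr do rewrite mulrBl.
  by rewrite sumrB -mulr_sumr m1 mulr1 subrr.
pose L := \sum_k \sum_l (h k + h l) * a k l.
pose Q := \sum_k \sum_l h k * h l * a k l.
pose S := \sum_k \sum_l (z k + z l) * a k l.
have LE : L = S - 2 * Z * A.
  rewrite /L /S /A mulr_sumr -sumrB; apply: eq_bigr => k _.
  rewrite mulr_sumr -sumrB; apply: eq_bigr => l _; rewrite /h; ring.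
have QE : Q = \sum_k \sum_l z k * z l * a k l - Z * S + Z ^+ 2 * A.
  rewrite /Q /S /A !mulr_sumr -sumrB -big_split; apply: eq_bigr => k _ /=.
  rewrite !mulr_sumr -sumrB -big_split; apply: eq_bigr => l _ /=; rewrite /h; ring.
(* For |t| <= 1/B every |t h_k| is at most 1, so the weights 1 + t h_k stay nonnegative. *)
pose B := 1 + \sum_k `|h k|.
have B0 : 0 < B by rewrite ltr_wpDr ?sumr_ge0.
have pert t : `|t| <= B^-1 -> 0 <= t * L + t ^+ 2 * Q.
  move=> tB; have := amin (fun k => 1 + t * h k).
  have -> : \sum_k \sum_l (1 + t * h k) * (1 + t * h l) * a k l
      = A + (t * L + t ^+ 2 * Q).
    rewrite /L /Q /A !mulr_sumr -!big_split; apply: eq_bigr => k _ /=.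
    rewrite !mulr_sumr -!big_split; apply: eq_bigr => l _ /=; ring.
  rewrite lerDl; apply => [k|].
    suff : `|t * h k| <= 1 by rewrite ler_norml -subr_ge0 opprK addrC => /andP[].
    rewrite normrM (le_trans (ler_pM _ _ tB (_ : _ <= B)))//.
      by rewrite /B (bigD1 k)//= addrCA lerDl addr_ge0// sumr_ge0.
    by rewrite mulVf ?gt_eqF.
  under eq_bigr do rewrite mulrDl mul1r -mulrA.
  by rewrite big_split /= -mulr_sumr m1 hm mulr0 addr0.
have [|L0 Q0] := quadratic_ge0_near0 _ pert; first by rewrite invr_gt0.
move: Q0 L0; rewrite QE LE => Q0 /eqP; rewrite subr_eq0 => /eqP SE.
rewrite SE in Q0; rewrite -subr_ge0 (le_trans Q0)// le_eqVlt; apply/orP; left.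
by apply/eqP; move: (\sum_k \sum_l z k * z l * a k l) => W; clearbody Z A; ring.
Qed.

(** * Energies of densities that are constant on the cells of a partition *)

Lemma ge0_integral_mrestr d (T : measurableType d) (R : realType)
    (mu : {measure set T -> \bar R}) (A : set T) (mA : measurable A)
    (f : T -> \bar R) :
  measurable_fun setT f -> (forall x, 0 <= f x)%E ->
  (\int[mrestr mu mA]_x f x = \int[mu]_(x in A) f x)%E.
Proof.
move=> mf f0; rewrite -(setUv A) ge0_integral_setU//; last 3 first.
- exact: measurableC.
- by rewrite setUv.
- by rewrite disj_set2E setICr.
rewrite [X in (_ + X)%E](_ : _ = 0)%E; last first.
  rewrite -(@integral_measure_zero _ T R (~` A) f).
  apply: eq_measure_integral => B mB BA.
  rewrite [LHS](_ : _ = mu (B `&` A))//.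
  by rewrite (_ : B `&` A = set0) ?measure0//; exact/disjoints_subset.
rewrite adde0; apply: eq_measure_integral => B mB BA.
by rewrite [LHS](_ : _ = mu (B `&` A))// setIidl.
Qed.

Lemma measurable_integral_section d (T : measurableType d) (R : realType)
    (K : T -> T -> R) (mu : probability T R) (A : set T) :
  measurable_fun setT (fun u : T * T => K u.1 u.2) ->
  (forall x y, 0 <= K x y) -> measurable A ->
  measurable_fun setT (fun x => \int[mu]_(y in A) (K x y)%:E)%E.
Proof.
move=> mK K0 mA.
have mKx x : measurable_fun setT (fun y => (K x y)%:E).
  exact/measurable_EFinP/(measurable_fun_pair2 x mK).
have K0' x y : (0 <= (K x y)%:E)%E by rewrite lee_fin.
under eq_fun do rewrite -(ge0_integral_mrestr mu mA (mKx _) (K0' _)).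
apply: (@measurable_fun_fubini_tonelli_F _ _ _ _ _ (mrestr mu mA)
  (fun u : T * T => (K u.1 u.2)%:E)) => //.
exact/measurable_EFinP.
Qed.

Lemma double_integral_bounds d (T : measurableType d) (R : realType)
    (K : T -> T -> R) (mu : probability T R) (A B : set T) (lo hi : R) :
  measurable_fun setT (fun u : T * T => K u.1 u.2) ->
  (forall x y, 0 <= K x y) -> measurable A -> measurable B -> 0 <= lo ->
  (forall x y, A x -> B y -> lo <= K x y <= hi) ->
  lo * (fine (mu A) * fine (mu B)) <=
    fine (\int[mu]_(x in A) \int[mu]_(y in B) (K x y)%:E)%E <=
    hi * (fine (mu A) * fine (mu B)).
Proof.
move=> mK K0 mA mB lo0 KAB.
have mKx x : measurable_fun setT (fun y => (K x y)%:E).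
  exact/measurable_EFinP/(measurable_fun_pair2 x mK).
have mF := measurable_integral_section mu mK K0 mB.
have K0' x y : (0 <= (K x y)%:E)%E by rewrite lee_fin.
have F0 x : (0 <= \int[mu]_(y in B) (K x y)%:E)%E by exact: integral_ge0.
have fA : mu A \is a fin_num by exact: fin_num_measure.
have fB : mu B \is a fin_num by exact: fin_num_measure.
have inner x : A x ->
    (lo%:E * mu B <= \int[mu]_(y in B) (K x y)%:E <= hi%:E * mu B)%E.
  move=> Ax; rewrite -!integral_cst//; apply/andP; split.
    apply: ge0_le_integral => //; first exact: measurable_funTS.
    by move=> y By; rewrite lee_fin; have /andP[] := KAB x y Ax By.
  apply: ge0_le_integral => //; first exact: measurable_funTS.
  by move=> y By; rewrite lee_fin; have /andP[] := KAB x y Ax By.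
have fin : (\int[mu]_(x in A) \int[mu]_(y in B) (K x y)%:E \is a fin_num)%E.
  rewrite ge0_fin_numE ?integral_ge0//.
  apply: (@le_lt_trans _ _ (\int[mu]_(x in A) cst (hi%:E * mu B) x)%E).
    apply: ge0_le_integral => //; first exact: measurable_funTS.
    by move=> x Ax; have /andP[] := inner x Ax.
  by rewrite integral_cst// ltey_eq !fin_numM.
rewrite -!lee_fin fineK//.
have cstE (r : R) : (r * (fine (mu A) * fine (mu B)))%:E
    = (\int[mu]_(x in A) cst (r%:E * mu B) x)%E.
  by rewrite integral_cst// mulrCA mulrC !EFinM !fineK.
rewrite !cstE; apply/andP; split; apply: ge0_le_integral => //.
- by move=> x _; rewrite mule_ge0// lee_fin.
- exact: measurable_funTS.
- by move=> x Ax; have /andP[] := inner x Ax.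
- exact: measurable_funTS.
- by move=> x Ax; have /andP[] := inner x Ax.
Qed.

(** Competitors with constant density on each cell reduce the minimality of [mu] to a minimum of a
    quadratic form in finitely many weights. *)
Lemma partition_quadratic_form d (T : measurableType d) (R : realType)
    (K : T -> T -> R) (mu : probability T R) (n : nat)
    (A : 'I_n.+1 -> set T) (z : 'I_n.+1 -> R) :
  measurable_fun setT (fun u : T * T => K u.1 u.2) ->
  (forall x y, 0 <= K x y <= 1) ->
  (forall nu : probability T R,
    (\int[mu]_x \int[mu]_y (K x y)%:E <= \int[nu]_x \int[nu]_y (K x y)%:E)%E) ->
  (forall k, measurable (A k)) -> trivIset setT A -> \big[setU/set0]_k A k = setT ->
  (\sum_k z k * fine (mu (A k))) ^+ 2 *
     fine (\int[mu]_x \int[mu]_y (K x y)%:E)%E <=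
  \sum_k \sum_l z k * z l *
     fine (\int[mu]_(x in A k) \int[mu]_(y in A l) (K x y)%:E)%E.
Proof.
move=> mK K01 mumin mA tA cA.
have K0 x y : (0 <= (K x y)%:E)%E by rewrite lee_fin; have /andP[] := K01 x y.
have mKx x : measurable_fun setT (fun y => (K x y)%:E).
  apply/measurable_EFinP.
  exact: (measurable_fun_pair2 x mK).
have mF (nu : probability T R) :
    measurable_fun setT (fun x => \int[nu]_y (K x y)%:E)%E.
  apply: (@measurable_fun_fubini_tonelli_F _ _ _ _ _ nu
    (fun u : T * T => (K u.1 u.2)%:E)) => //.
  exact/measurable_EFinP.
(* [M w] has density [w k] on [A k]; [inord] appears because [msum] is indexed by [nat]. *)
pose M (w : 'I_n.+1 -> {nonneg R}) : {measure set T -> \bar R} :=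
  msum (fun k => mscale (w (inord k)) (mrestr mu (mA (inord k)))) n.+1.
have ME w (f : T -> \bar R) : measurable_fun setT f -> (forall x, 0 <= f x)%E ->
    (\int[M w]_x f x = \sum_k (w k)%:num%:E * \int[mu]_(x in A k) f x)%E.
  move=> mf f0; rewrite ge0_integral_measure_sum//; apply: eq_bigr => k _.
  by rewrite ge0_integral_mscale//= ge0_integral_mrestr// inord_val.

have I01 (f : T -> \bar R) (B : set T) : measurable B -> measurable_fun setT f ->
    (forall x, 0 <= f x <= 1)%E -> (0 <= \int[mu]_(x in B) f x <= 1)%E.
  move=> mB mf f01; have f0 x : (0 <= f x)%E by have /andP[] := f01 x.
  rewrite integral_ge0//= (@le_trans _ _ (\int[mu]_(x in B) cst 1 x)%E)//.
    apply: ge0_le_integral => //.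
    - exact: measurable_funTS.
    - by move=> x _; have /andP[] := f01 x.
  by rewrite integral_cst// mul1e probability_le1.
have part (f : T -> \bar R) : measurable_fun setT f -> (forall x, 0 <= f x)%E ->
    (\int[mu]_x f x = \sum_k \int[mu]_(x in A k) f x)%E.
  move=> mf f0; rewrite -cA ge0_integral_bigsetU//.
  - exact: index_enum_uniq.
  - exact: sub_trivIset tA.
  - exact: measurable_funTS.
pose a k l := (\int[mu]_(x in A k) \int[mu]_(y in A l) (K x y)%:E)%E.
have mFA l : measurable_fun setT (fun x => \int[mu]_(y in A l) (K x y)%:E)%E.
  by apply: measurable_integral_section => // x y; have /andP[] := K01 x y.
have FA0 l x : (0 <= \int[mu]_(y in A l) (K x y)%:E <= 1)%E.
  by apply: I01 => // y; rewrite !lee_fin.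
have afin k l : a k l \is a fin_num.
  have /andP[a0 a1] : (0 <= a k l <= 1)%E by exact: I01.
  by rewrite ge0_fin_numE// (le_lt_trans a1)// ltry.
have mufin k : mu (A k) \is a fin_num by exact: fin_num_measure.
(* Stated for any probability that agrees with [M w], this covers both [mu] itself, with all weights
   1, and the competitor [nu]. *)
have energyM w (nu : probability T R) : (forall B, measurable B -> nu B = M w B) ->
    (\int[nu]_x \int[nu]_y (K x y)%:E =
     (\sum_k \sum_l (w k)%:num * (w l)%:num * fine (a k l))%:E)%E.
  move=> nuM.
  have nuE (f : T -> \bar R) : (\int[nu]_x f x = \int[M w]_x f x)%E.
    by apply: eq_measure_integral => B mB _; exact: nuM.
  rewrite nuE ME//; last by move=> x; exact: integral_ge0.
  rewrite -sumEFin; apply: eq_bigr => k _.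
  under eq_integral => x _ do rewrite nuE ME//.
  rewrite ge0_integral_sum//; last 2 first.
  - by move=> l; apply: measurable_funeM; exact: measurable_funTS.
  - by move=> l x _; rewrite mule_ge0//; have /andP[] := FA0 l x.
  rewrite ge0_sume_distrr; last first.
    move=> l _; apply: integral_ge0 => x _.
    by rewrite mule_ge0//; have /andP[] := FA0 l x.
  rewrite -sumEFin; apply: eq_bigr => l _.
  rewrite ge0_integralZl//; last 2 first.
  - exact: measurable_funTS.
  - by move=> x _; have /andP[] := FA0 l x.
  by rewrite -/(a k l) muleA !EFinM fineK.

have m1 : \sum_k fine (mu (A k)) = 1.
  apply: EFin_inj; rewrite -sumEFin; under eq_bigr do rewrite fineK//.
  rewrite -(@probability_setT _ _ _ mu) -[in RHS](mul1e (mu setT)) -integral_cst//.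
  rewrite (part (cst 1%E))//; apply: eq_bigr => k _.
  by rewrite integral_cst// mul1e.
have MB w B : measurable B -> M w B = (\sum_k (w k)%:num%:E * mu (B `&` A k))%E.
  move=> mB; have mI : measurable_fun setT (fun x => (\1_B x)%:E : \bar R).
    exact/measurable_EFinP/measurable_indic.
  have := ME w _ mI; rewrite integral_indic// setIT => ->.
    by apply: eq_bigr => k _; rewrite integral_indic.
  by move=> x; rewrite lee_fin.
have muB B : measurable B -> mu B = (\sum_k mu (B `&` A k))%E.
  move=> mB; have mI : measurable_fun setT (fun x => (\1_B x)%:E : \bar R).
    exact/measurable_EFinP/measurable_indic.
  have := part _ mI; rewrite integral_indic// setIT => ->.
    by apply: eq_bigr => k _; rewrite integral_indic.
  by move=> x; rewrite lee_fin.
have emu : (\int[mu]_x \int[mu]_y (K x y)%:E = (\sum_k \sum_l fine (a k l))%:E)%E.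
  rewrite (energyM (fun=> 1%:nng) mu) /=.
    by congr EFin; apply: eq_bigr => k _; apply: eq_bigr => l _; rewrite !mul1r.
  move=> B mB; rewrite muB// (MB (fun=> 1%:nng))//.
  by apply: eq_bigr => k _; rewrite mul1e.
rewrite emu /=; apply: quadratic_form_minimum => // w w0 w1.
pose W k : {nonneg R} := NngNum (w0 k).
(* The mass is already 1: normalizing changes no value and only provides the probability structure,
   with [mu] as default. *)
pose nu := mnormalize (M W) mu.
have MW1 : M W setT = 1%E.
  rewrite MB// -w1 -sumEFin; apply: eq_bigr => k _.
  by rewrite setTI EFinM fineK.
have nuM B : measurable B -> nu B = M W B.
  by move=> mB; rewrite /nu /mnormalize MW1 onee_eq0 /= invr1 mule1.
have := mumin nu; rewrite emu (energyM W nu nuM) lee_fin.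
exact.
Qed.

(** * Continuity and measurability of the kernel on the sphere *)

Lemma norm_powR_continuous (R : realType) (p : R) : 0 < p ->
  continuous (fun x : R => `|x| `^ p).
Proof.
move=> p0 x; have [->|x0] := eqVneq x 0; last first.
  apply: (@continuous_comp _ _ _ (fun x : R => `|x|) (fun y => y `^ p)).
    exact: norm_continuous.
  apply: differentiable_continuous; apply/derivable1_diffP.
  by apply: derivable_powR; rewrite in_itv/= normr_gt0 x0.
rewrite /continuous_at normr0 powR0 ?gt_eqF//; apply/cvgrPdist_lt => e e0.
have d0 : 0 < e `^ p^-1 by rewrite powR_gt0.
have : \forall y \near (0 : R), `|y| < e `^ p^-1 by exact: nbhs0_lt.
apply: filterS => y yd; rewrite sub0r normrN ger0_norm ?powR_ge0//.
have -> : (e : R) = (e `^ p^-1) `^ p.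
  by rewrite -powRrM mulVf ?gt_eqF// powRr1 ?ltW.
by apply: (gt0_ltr_powR p0); rewrite ?nnegrE ?normr_ge0 ?powR_ge0.
Qed.

Lemma dotr_continuous (R : realType) (d : nat) :
  continuous (fun u : 'rV[R]_d * 'rV[R]_d => dotr u.1 u.2).
Proof.
rewrite /dotr; apply: continuous_big => [|i _].
  exact: add_continuous.
move=> u; apply: cvgM.
- apply: (@continuous_comp _ _ _ fst (fun v : 'rV[R]_d => v 0 i)).
    exact: cvg_fst.
  exact: coord_continuous.
- apply: (@continuous_comp _ _ _ snd (fun v : 'rV[R]_d => v 0 i)).
    exact: cvg_snd.
  exact: coord_continuous.
Qed.

Lemma usphere_measurable (R : realType) (n : nat) (f : 'rV[R]_n.+1 -> R) :
  continuous f -> measurable_fun setT (fun x : usphere R n => f (set_val x)).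
Proof.
move=> cf; apply: (measurability _ (RGenOpens.measurableE R)).
move=> _ [_ [a [b ->] <-]]; rewrite setTI; apply: sub_sigma_algebra.
have : continuous (f \o (set_val : usphere R n -> 'rV[R]_n.+1)).
  by move=> x; apply: continuous_comp; [exact: initial_continuous|exact: cf].
by move/continuousP; apply; exact: interval_open.
Qed.

(** Measurability is meant for the product of the Borel sigma-algebras, so it is derived coordinate
    by coordinate. *)
Lemma udot_measurable (R : realType) (n : nat) :
  measurable_fun setT (fun u : usphere R n * usphere R n => udot u.1 u.2).
Proof.
apply: measurable_sum => i; apply: measurable_funM.
- have m := @usphere_measurable R n (fun v => v 0 i) (@coord_continuous _ _ _ 0 i).
  exact: (measurableT_comp m measurable_fst).
- have m := @usphere_measurable R n (fun v => v 0 i) (@coord_continuous _ _ _ 0 i).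
  exact: (measurableT_comp m measurable_snd).
Qed.

Lemma udot_self (R : realType) (n : nat) (x : usphere R n) : udot x x = 1.
Proof. exact: (set_valP x). Qed.

Lemma udot_norm_le1 (R : realType) (n : nat) (x y : usphere R n) :
  `|udot x y| <= 1.
Proof.
have sq (z : usphere R n) : \sum_i set_val z 0 i ^+ 2 = 1.
  by rewrite -(udot_self z); apply: eq_bigr => i _; rewrite expr2.
rewrite (le_trans (ler_norm_sum _ _ _))//.
have -> : 1 = \sum_(i < n.+1) (set_val x 0 i ^+ 2 + set_val y 0 i ^+ 2) / 2 :> R.
  by rewrite -mulr_suml big_split /= !sq; field.
apply: ler_sum => i _; rewrite ler_norml.
have := sqr_ge0 (set_val x 0 i + set_val y 0 i).
have := sqr_ge0 (set_val x 0 i - set_val y 0 i).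
by move=> h1 h2; apply/andP; split; lra.
Qed.

Definition uball (R : realType) (n : nat) (x : usphere R n) (r : R) :=
  [set y : usphere R n | `|set_val x - set_val y| < r].

Lemma open_uball (R : realType) (n : nat) (x : usphere R n) (r : R) :
  open (uball x r).
Proof.
exists (ball (set_val x) r); first exact: ball_open.
by rewrite -ball_normE.
Qed.

Lemma measurable_uball (R : realType) (n : nat) (x : usphere R n) (r : R) :
  measurable (uball x r).
Proof. by apply: sub_sigma_algebra; exact: open_uball. Qed.

(** The condition for a pair of indices passes to smaller radii, so it holds for all r near 0+;
    finitely many such conditions hold together. *)
Lemma small_uballs (R : realType) (n k : nat) (p e : R)
    (x : 'I_k -> usphere R n) : 0 < p -> 0 < e -> injective x ->
  exists2 r, 0 < r & forall i j,
    (i != j -> uball (x i) r `&` uball (x j) r = set0) /\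
    forall y z, uball (x i) r y -> uball (x j) r z ->
      `| `|udot (x i) (x j)| `^ p - `|udot y z| `^ p | < e.
Proof.
move=> p0 e0 xinj.
pose P i j (r : R) := (i != j -> uball (x i) r `&` uball (x j) r = set0) /\
    forall y z, uball (x i) r y -> uball (x j) r z ->
      `| `|udot (x i) (x j)| `^ p - `|udot y z| `^ p | < e.
have Pij i j : \forall r \near 0^'+, P i j r.
  have [d d0 Hd] : exists2 d : R, 0 < d & P i j d.
    have cK : continuous
        (fun u : 'rV[R]_n.+1 * 'rV[R]_n.+1 => `|dotr u.1 u.2| `^ p).
      move=> u; apply: (@continuous_comp _ _ _
        (fun u : 'rV[R]_n.+1 * 'rV[R]_n.+1 => dotr u.1 u.2)
        (fun y : R => `|y| `^ p)).
        exact: dotr_continuous.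
      exact: norm_powR_continuous.
    have /cvgrPdist_lt/(_ e e0)/nbhs_ballP[d1 /= d10 H1] :=
      cK (set_val (x i), set_val (x j)).
    have H2 r y z : r <= d1 -> uball (x i) r y -> uball (x j) r z ->
        `| `|udot (x i) (x j)| `^ p - `|udot y z| `^ p | < e.
      move=> rd yi zj.
      apply: (H1 (set_val y, set_val z)); split; rewrite -ball_normE /=.
        exact: lt_le_trans yi rd.
      exact: lt_le_trans zj rd.
    have [ij|ij] := eqVneq i j.
      by exists d1 => //; split=> [|y z]; [rewrite ij eqxx|exact: H2].
    (* At half the distance of the centres, the triangle inequality separates the balls. *)
    pose d2 := `|set_val (x i) - set_val (x j)| / 2.
    have d20 : 0 < d2.
      rewrite divr_gt0// normr_gt0 subr_eq0; apply: contra ij => /eqP/val_inj.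
      by move=> /xinj ->.
    exists (Num.min d1 d2); first by rewrite lt_min d10 d20.
    split=> [_|y z]; last by apply: H2; rewrite ge_min lexx.
    apply/seteqP; split => // y [/= yi yj].
    have : `|set_val (x i) - set_val (x j)| < d2 + d2; last first.
      by rewrite /d2 -splitr ltxx.
    rewrite -(subrKA (set_val y)) (le_lt_trans (ler_normD _ _))// distrC.
    apply: ltrD.
      by rewrite distrC (lt_le_trans yi)// ge_min lexx orbT.
    by rewrite distrC (lt_le_trans yj)// ge_min lexx orbT.
  near=> r.
  have rd : r < d by near: r; exact: nbhs_right_lt.
  have sub l : uball (x l) r `<=` uball (x l) d.
    by move=> y /= /lt_trans; apply.
  case: Hd => H1 H2; split=> [ij|y z yi zj]; last by apply: H2; exact: sub.
  by apply/seteqP; split => // y [] /sub yi /sub yj; rewrite -(H1 ij).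
have /filter_ex[r [r0 Pr]] : \forall r \near 0^'+, 0 < r /\ forall i j, P i j r.
  apply: filterI; first exact: nbhs_right_gt.
  exact: (@filter_forall _ _ (fun i r => forall j, P i j r) _ _
    (fun i => @filter_forall _ _ (P i) _ _ (Pij i))).
by exists r.
Unshelve. all: by end_near. Qed.

(** * Positive semidefiniteness on the support and positivity of the energy *)

Definition kernel (R : realType) (n : nat) (p : R) (x y : usphere R n) : R :=
  `|udot x y| `^ p.

Lemma kernel_measurable (R : realType) (n : nat) (p : R) :
  measurable_fun setT (fun u : usphere R n * usphere R n => kernel p u.1 u.2).
Proof.
apply: (measurableT_comp (measurable_powR p)).
exact: (measurableT_comp (@normr_measurable R setT) (@udot_measurable R n)).
Qed.

Lemma kernel_itv (R : realType) (n : nat) (p : R) (x y : usphere R n) :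
  0 < p -> 0 <= kernel p x y <= 1.
Proof.
move=> p0; rewrite powR_ge0 /= [leRHS](_ : _ = 1 `^ p); last by rewrite powR1.
by apply: ge0_ler_powR; rewrite ?nnegrE ?(ltW p0) ?udot_norm_le1.
Qed.

Lemma supp_uball_gt0 (R : realType) (n : nat) (mu : probability (usphere R n) R)
    (x : usphere R n) (r : R) : supp mu x -> 0 < r -> 0 < fine (mu (uball x r)).
Proof.
move=> sx r0; apply: fine_gt0; apply/andP; split.
  apply: sx; first exact: open_uball.
  by rewrite /uball /= subrr normr0.
rewrite (le_lt_trans (probability_le1 _ _)) ?ltry//.
exact: measurable_uball.
Qed.

(** The cells are small disjoint balls around the [x i], of positive mass, and the rest of the
    sphere as cell 0. With the values c_i / mu(B_i) on the balls and 0 elsewhere, the form of the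
    partition averages the kernel over pairs of balls, within [e] of its values at the centres. *)
Lemma minimizer_psd (R : realType) (n k : nat) (p : R)
    (mu : probability (usphere R n) R) (x : 'I_k -> usphere R n) (c : 'I_k -> R) :
  0 < p -> minimizer p mu -> injective x -> (forall i, supp mu (x i)) ->
  (\sum_i c i) ^+ 2 * fine (energy p mu) <=
    \sum_i \sum_j c i * c j * kernel p (x i) (x j).
Proof.
move=> p0 mumin xinj xs.
suff main e : 0 < e -> (\sum_i c i) ^+ 2 * fine (energy p mu) <=
    \sum_i \sum_j c i * c j * kernel p (x i) (x j) + (\sum_i `|c i|) ^+ 2 * e.
  apply/ler_addgt0Pr => d d0; pose C := (\sum_i `|c i|) ^+ 2 + 1.
  have C0 : 0 < C by rewrite ltr_wpDl ?sqr_ge0.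
  rewrite (le_trans (main (d / C) _)) ?divr_gt0// lerD2l mulrCA ger_pMr//.
  by rewrite ler_pdivrMr// mul1r lerDl.
move=> e0; have [r r0 Hr] := small_uballs p0 e0 xinj.
pose B i := uball (x i) r.
have mB i : measurable (B i) by exact: measurable_uball.
pose A (l : 'I_k.+1) := if unlift ord0 l is Some i then B i
  else ~` \big[setU/set0]_i B i.
pose z (l : 'I_k.+1) := if unlift ord0 l is Some i then c i / fine (mu (B i))
  else 0.
have mA l : measurable (A l).
  rewrite /A; case: unlift => [i|]; first exact: mB.
  by apply: measurableC; apply: bigsetU_measurable => i _; exact: mB.
have AS i : A (lift ord0 i) = B i by rewrite /A liftK.
have A0 : A ord0 = ~` \big[setU/set0]_i B i by rewrite /A unlift_none.
have tA : trivIset setT A.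
  have AB i : A ord0 `&` A (lift ord0 i) = set0.
    rewrite A0 AS; apply/seteqP; split => // y [nB Biy]; apply: nB.
    by rewrite (bigD1 i)//=; left.
  apply/trivIsetP => l1 l2 _ _.
  case: (unliftP ord0 l1) => [i|] ->; case: (unliftP ord0 l2) => [j|] -> // ij.
  - rewrite !AS; have [+ _] := Hr i j; apply.
    by move: ij; rewrite (inj_eq (@lift_inj _ _)).
  - by rewrite setIC.
have cA : \big[setU/set0]_l A l = setT.
  by rewrite big_ord_recl A0 (eq_bigr B (fun i _ => AS i)) setUC setUv.
have := @partition_quadratic_form _ _ _ (@kernel R n p) mu k A z
  (@kernel_measurable R n p) (fun x y => kernel_itv x y p0) mumin mA tA cA.
pose m i := fine (mu (B i)).
have m0 i : 0 < m i by exact: supp_uball_gt0.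
pose b i j := fine (\int[mu]_(x in B i) \int[mu]_(y in B j) (kernel p x y)%:E)%E.
have z0 : z ord0 = 0 by rewrite /z unlift_none.
have zS i : z (lift ord0 i) = c i / m i by rewrite /z liftK.
have -> : \sum_l z l * fine (mu (A l)) = \sum_i c i.
  rewrite big_ord_recl z0 mul0r add0r; apply: eq_bigr => i _.
  by rewrite zS AS divfK// gt_eqF.
have -> : \sum_l \sum_h z l * z h * fine (\int[mu]_(x in A l) \int[mu]_(y in A h)
      (kernel p x y)%:E)%E = \sum_i \sum_j (c i / m i) * (c j / m j) * b i j.
  rewrite big_ord_recl big1 ?add0r => [|l _]; last by rewrite z0 !mul0r.
  apply: eq_bigr => i _; rewrite big_ord_recl z0 mulr0 mul0r add0r.
  by apply: eq_bigr => j _; rewrite !zS !AS.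
move=> /le_trans; apply.
rewrite expr2 mulr_suml mulr_suml -big_split; apply: ler_sum => i _ /=.
rewrite mulr_sumr mulr_suml -big_split; apply: ler_sum => j _ /=.
have K0 (u v : usphere R n) : 0 <= kernel p u v by exact: powR_ge0.
have bE : `|b i j / (m i * m j) - kernel p (x i) (x j)| <= e.
  have close u v : B i u -> B j v -> `|kernel p (x i) (x j) - kernel p u v| < e.
    by have [_] := Hr i j; apply.
  (* The maximum with 0 provides the nonnegative lower bound that [double_integral_bounds] takes. *)
  have lo0 : 0 <= Num.max 0 (kernel p (x i) (x j) - e) by rewrite le_max lexx.
  have [] := andP (@double_integral_bounds _ _ _ (@kernel R n p) mu (B i) (B j)
    _ (kernel p (x i) (x j) + e) (@kernel_measurable R n p) K0 (mB i) (mB j) lo0 _).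
    move=> u v Bu Bv; have := close u v Bu Bv.
    rewrite ltr_distl ge_max K0 /= => /andP[h1 h2].
    by apply/andP; split; lra.
  rewrite -/(m i) -/(m j) -/(b i j) -ler_pdivlMr ?mulr_gt0// ge_max.
  move=> /andP[_ h1]; rewrite -ler_pdivrMr ?mulr_gt0// => h2.
  by rewrite ler_distl h1 h2.
rewrite [leLHS](_ : _ = c i * c j * (b i j / (m i * m j))); last first.
  by field; rewrite !gt_eqF.
rewrite -lerBlDl -mulrBr (le_trans (ler_norm _))// normrM [`|c i * _|]normrM.
by rewrite ler_wpM2l ?mulr_ge0.
Qed.

(** The kernel is 1 at (x, x), hence at least 1/2 on a small ball around x, which has positive
    mass. *)
Lemma energy_gt0 (R : realType) (n : nat) (p : R)
    (mu : probability (usphere R n) R) (x : usphere R n) :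
  0 < p -> supp mu x -> 0 < fine (energy p mu).
Proof.
move=> p0 sx.
have xinj : injective (fun _ : 'I_1 => x) by move=> i j _; rewrite !ord1.
have half : 0 < 1 / 2 :> R by rewrite divr_gt0.
have [r r0 Hr] := small_uballs p0 half xinj.
have mB : measurable (uball x r) by exact: measurable_uball.
have K0 (u v : usphere R n) : 0 <= kernel p u v by exact: powR_ge0.
have K0' (u v : usphere R n) : (0 <= (kernel p u v)%:E)%E by rewrite lee_fin.
have m0 := supp_uball_gt0 sx r0.
have mK := @kernel_measurable R n p.
have mKx (u : usphere R n) : measurable_fun setT (fun v => (kernel p u v)%:E).
  by apply/measurable_EFinP; exact: (measurable_fun_pair2 u mK).
have mF B : measurable B ->
    measurable_fun setT (fun u => \int[mu]_(v in B) (kernel p u v)%:E)%E.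
  exact: (measurable_integral_section mu mK K0).
have F0 B u : (0 <= \int[mu]_(v in B) (kernel p u v)%:E)%E by exact: integral_ge0.
have bnd u v : uball x r u -> uball x r v -> 1 / 2 <= kernel p u v <= 1.
  move=> xu xv; have /andP[_ ->] := kernel_itv u v p0.
  have [_ /(_ u v xu xv)] := Hr ord0 ord0.
  rewrite udot_self normr1 powR1 ltr_distl => /andP[_]; rewrite /kernel; lra.
have /andP[low _] := double_integral_bounds mu mK K0 mB mB (ltW half) bnd.
have pos : 0 < fine (\int[mu]_(u in uball x r) \int[mu]_(v in uball x r)
    (kernel p u v)%:E)%E.
  by rewrite (lt_le_trans _ low)// mulr_gt0 ?mulr_gt0.
(* Finiteness matters here, since [fine] sends an infinite energy to 0. *)
have e1 : (energy p mu <= 1)%E.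
  have cst1 : (\int[mu]_(u in setT) cst 1 u = 1)%E.
    by rewrite integral_cst// mul1e; exact: probability_setT.
  rewrite -cst1; apply: ge0_le_integral => //.
  - by move=> u _; exact: F0.
  - exact: (mF _ measurableT).
  - move=> u _; rewrite [leRHS](_ : _ = \int[mu]_(v in setT) cst 1 v)%E//.
    apply: ge0_le_integral => //.
    + exact: mKx.
    + by move=> v _; rewrite lee_fin; have /andP[] := kernel_itv u v p0.
have le1 : (\int[mu]_(u in uball x r) \int[mu]_(v in uball x r) (kernel p u v)%:E
    <= energy p mu)%E.
  apply: (@le_trans _ _ (\int[mu]_(u in uball x r) \int[mu]_v (kernel p u v)%:E)%E).
    apply: ge0_le_integral => //; first exact: measurable_funTS (mF _ mB).
      exact: measurable_funTS (mF _ measurableT).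
    by move=> u _; apply: ge0_subset_integral.
  by apply: ge0_subset_integral => //; exact: (mF _ measurableT).
have eoo : (energy p mu < +oo)%E by exact: le_lt_trans e1 (ltry 1).
have fin : (\int[mu]_(u in uball x r) \int[mu]_(v in uball x r)
    (kernel p u v)%:E)%E \is a fin_num.
  rewrite ge0_fin_numE; first exact: (le_lt_trans le1 eoo).
  by apply: integral_ge0 => u _; exact: F0.
apply: fine_gt0; apply/andP; split=> //; apply: lt_le_trans le1.
by rewrite -(fineK fin) lte_fin.
Qed.

(** * Orthonormal coordinates on a great circle *)

Lemma dotrC (R : realType) (d : nat) (x y : 'rV[R]_d) : dotr x y = dotr y x.
Proof. by apply: eq_bigr => i _; rewrite mulrC. Qed.

Lemma dotrDl (R : realType) (d : nat) (x y z : 'rV[R]_d) :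
  dotr (x + y) z = dotr x z + dotr y z.
Proof. by rewrite -big_split; apply: eq_bigr => i _; rewrite mxE mulrDl. Qed.

Lemma dotrZl (R : realType) (d : nat) (a : R) (x z : 'rV[R]_d) :
  dotr (a *: x) z = a * dotr x z.
Proof. by rewrite mulr_sumr; apply: eq_bigr => i _; rewrite mxE mulrA. Qed.

Lemma dotrDr (R : realType) (d : nat) (x y z : 'rV[R]_d) :
  dotr z (x + y) = dotr z x + dotr z y.
Proof. by rewrite !(dotrC z) dotrDl. Qed.

Lemma dotrZr (R : realType) (d : nat) (a : R) (x z : 'rV[R]_d) :
  dotr z (a *: x) = a * dotr z x.
Proof. by rewrite !(dotrC z) dotrZl. Qed.

Lemma dotr_gt0 (R : realType) (d : nat) (x : 'rV[R]_d) : x != 0 -> 0 < dotr x x.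
Proof.
move=> x0; have sq i : 0 <= x 0 i * x 0 i by rewrite -expr2 sqr_ge0.
rewrite lt_neqAle eq_sym sumr_ge0 // andbT; apply: contra x0 => /eqP s0.
apply/eqP/rowP => i; rewrite mxE.
have := @psumr_eq0P _ _ xpredT (fun i => x 0 i * x 0 i) (fun i _ => sq i) s0 i isT.
by move/eqP; rewrite mulf_eq0 orbb => /eqP.
Qed.

Lemma dotr_unit (R : realType) (d : nat) (x : 'rV[R]_d) (s := Num.sqrt (dotr x x)) :
  x != 0 -> s != 0 /\ dotr (s^-1 *: x) (s^-1 *: x) = 1.
Proof.
move=> /dotr_gt0 x0; have s0 : s != 0 by rewrite gt_eqF// sqrtr_gt0.
split=> //; rewrite dotrZl dotrZr -[dotr x x]sqr_sqrtr ?ltW// -/s.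
by field.
Qed.

Lemma plane_orthonormal (R : realType) (n : nat) (V : {vspace 'rV[R]_n.+1}) :
  \dim V = 2%N -> exists e1 e2 : 'rV[R]_n.+1,
    [/\ dotr e1 e1 = 1, dotr e2 e2 = 1, dotr e1 e2 = 0 &
        forall x, x \in V -> exists a b, x = a *: e1 + b *: e2].
Proof.
move=> dV; have := basis_free (vbasisP V); have := span_basis (vbasisP V).
have : size (vbasis V) = 2%N by rewrite size_tuple.
case: (tval (vbasis V)) => [|v1 [|v2 [|//]]]//= _ sV.
rewrite free_cons span_seq1 => /andP[v1N].
rewrite free_cons span_nil memv0 => /andP[v20 _].
have v10 : v1 != 0 by apply: contra v1N => /eqP ->; rewrite mem0v.
have [s1 u2] := dotr_unit v20; set s := Num.sqrt _ in s1 u2.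
(* Gram-Schmidt: [w] is the part of [v1] orthogonal to [e2], nonzero because [v1] is not on the line
   of [v2]. *)
pose e2 := s^-1 *: v2; pose w := v1 - dotr v1 e2 *: e2.
have w0 : w != 0.
  apply: contra v1N; rewrite subr_eq0 => /eqP ->.
  by rewrite !memvZ// memv_line.
have [s2 u1] := dotr_unit w0; set r := Num.sqrt _ in s2 u1.
exists (r^-1 *: w), e2; split=> //.
  have orth (e v : 'rV[R]_n.+1) : dotr e e = 1 -> dotr (v - dotr v e *: e) e = 0.
    by move=> ee; rewrite dotrDl -scaleN1r !dotrZl ee; ring.
  by rewrite dotrZl /w orth ?mulr0.
move=> x; rewrite -sV span_cons span_seq1 => /memv_addP[_ /vlineP[k1 ->]].
move=> [_ /vlineP[k2 ->] ->].
exists (k1 * r), (k1 * dotr v1 e2 + k2 * s).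
rewrite scalerA -mulrA divff// mulr1 /w scalerBr scalerA scalerDl addrA subrK.
by rewrite /e2 [(k2 * s) *: _]scalerA -mulrA divff// mulr1.
Qed.

Lemma circle_coordinates (R : realType) (n : nat) (C : set (usphere R n)) :
  great_circle C -> exists a b : usphere R n -> R,
    forall x y, C x -> C y -> udot x y = a x * a y + b x * b y.
Proof.
move=> [V [dV ->]]; have [e1 [e2 [d11 d22 d12 eV]]] := plane_orthonormal dV.
exists (fun x => dotr (set_val x) e1), (fun x => dotr (set_val x) e2) => x y /=.
move=> /eV[a [b xE]] /eV[a' [b' yE]]; rewrite /udot xE yE.
rewrite !(dotrDl, dotrDr, dotrZl, dotrZr) (dotrC e2 e1) d11 d22 d12; ring.
Qed.

Lemma udot_eq1 (R : realType) (n : nat) (x y : usphere R n) :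
  udot x y = 1 -> x = y.
Proof.
move=> xy; apply/val_inj/eqP; rewrite -subr_eq0; apply/negPn/negP => /dotr_gt0.
rewrite -scaleN1r !(dotrDl, dotrDr, dotrZl, dotrZr).
rewrite (dotrC (\val y)) -[dotr (\val x) (\val x)]/(udot x x).
rewrite -[dotr (\val y) (\val y)]/(udot y y) -[dotr (\val x) (\val y)]/(udot x y).
rewrite !udot_self xy; lra.
Qed.

(** * Slopes of points on an open half circle *)

Section slopes.
Variables (R : realType) (n k : nat) (p : R) (mu : probability (usphere R n) R).
Variables (x : 'I_k -> usphere R n) (a b : 'I_k -> R).
Hypotheses (p_gt0 : 0 < p) (mumin : minimizer p mu) (xinj : injective x).
Hypotheses (suppx : forall i, supp mu (x i)) (a_gt0 : forall i, 0 < a i).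
Hypothesis xab : forall i j, udot (x i) (x j) = a i * a j + b i * b j.

Let t i := b i / a i.

Let udotE i j : udot (x i) (x j) = a i * a j * (1 + t i * t j).
Proof. by rewrite xab /t; field; rewrite !gt_eqF. Qed.

Let a_t i : a i ^+ 2 * (1 + t i ^+ 2) = 1.
Proof. by rewrite -[RHS](udot_self (x i)) udotE; ring. Qed.

(** By [a_t] the slope determines a_i^2, and a_i > 0 then fixes the point. *)
Lemma slopes_inj : injective t.
Proof.
move=> i j tij; apply/xinj/udot_eq1; rewrite udotE -tij.
have ti : 0 < 1 + t i ^+ 2 by rewrite ltr_wpDr ?sqr_ge0.
have : a i ^+ 2 = a j ^+ 2.
  by apply: (mulIf (lt0r_neq0 ti)); rewrite a_t tij a_t.
move=> /eqP; rewrite eqrXn2 ?ltW// => /eqP <-.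
by rewrite -[RHS](a_t i); ring.
Qed.

(** The coefficients d_i / a_i^p cancel the factors a_i^p a_j^p on the right, and a_i^(-p) is (1 +
    t_i^2)^(p/2) on the left. The sign condition removes the absolute value in the kernel. *)
Lemma minimizer_psd_slopes (d : 'I_k -> R) :
  (forall i j, 0 <= 1 + t i * t j) ->
  (\sum_i d i * (1 + t i ^+ 2) `^ (p / 2)) ^+ 2 * fine (energy p mu) <=
    \sum_i \sum_j d i * d j * (1 + t i * t j) `^ p.
Proof.
move=> t0; have ap i : a i `^ p != 0 by rewrite gt_eqF ?powR_gt0.
have := minimizer_psd (fun i => d i / a i `^ p) p_gt0 mumin xinj suppx.
have -> : \sum_i d i / a i `^ p = \sum_i d i * (1 + t i ^+ 2) `^ (p / 2).
  apply: eq_bigr => i _; congr (_ * _).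
  have -> : 1 + t i ^+ 2 = (a i)^-1 `^ 2.
    rewrite powR_mulrn ?invr_ge0 ?ltW// exprVn.
    have a2 := expf_neq0 2 (lt0r_neq0 (a_gt0 i)).
    by apply: (mulfI a2); rewrite a_t mulfV.
  rewrite -powRrM mulrCA divff ?mulr1//.
  by rewrite -(powR_inv1 (ltW (a_gt0 i))) -powRrM mulN1r powRN.
move=> /le_trans; apply; rewrite le_eqVlt; apply/orP; left; apply/eqP.
apply: eq_bigr => i _; apply: eq_bigr => j _.
have ai0 := ltW (a_gt0 i); have aj0 := ltW (a_gt0 j).
have aij := mulr_ge0 ai0 aj0.
rewrite /kernel udotE (ger0_norm (mulr_ge0 aij (t0 i j))).
rewrite (powRM _ aij (t0 i j)) (powRM _ ai0 aj0).
by field; rewrite !ap.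
Qed.

End slopes.

(** * Arcs with few support points, and the bounds on a circle *)

(** Within a quadrant inner products are nonnegative, so the kernel is the polynomial (x_i.x_j)^m.
    The right side of the slope inequality vanishes while its left side is positive. *)
Lemma odd_arc (R : realType) (n m : nat) (mu : probability (usphere R n) R)
    (x : 'I_m.+2 -> usphere R n) (a b : 'I_m.+2 -> R) :
  odd m -> minimizer m%:R mu -> injective x -> (forall i, supp mu (x i)) ->
  (forall i, 0 < a i) -> (forall i, 0 <= b i) ->
  (forall i j, udot (x i) (x j) = a i * a j + b i * b j) -> False.
Proof.
move=> om mumin xinj sx a0 b0 xab.
have p0 : 0 < m%:R :> R.
  by rewrite ltr0n; case: m om {mumin x a b xinj sx a0 b0 xab}.
pose t i := b i / a i.
have tinj : injective t := slopes_inj xinj a0 xab.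
have t0 i j : 0 <= 1 + t i * t j.
  by rewrite addr_ge0// mulr_ge0// divr_ge0// ltW.
have := minimizer_psd_slopes p0 mumin xinj sx a0 xab (dd_weight t) t0.
have -> : \sum_i \sum_j dd_weight t i * dd_weight t j * (1 + t i * t j) `^ m%:R = 0.
  apply: big1 => i _.
  pose P : {poly R} := (1 + t i *: 'X) ^+ m.
  have PE j : P.[t j] = (1 + t i * t j) `^ m%:R.
    by rewrite powR_mulrn// /P horner_exp !hornerE.
  have sP : (size P <= m.+1)%N.
    have s2 : (size (1 + t i *: 'X : {poly R})%R <= 2)%N.
      rewrite (leq_trans (size_polyD _ _))// geq_max size_poly1 /=.
      by rewrite (leq_trans (size_scale_leq _ _))// size_polyX.
    rewrite (leq_trans (size_poly_exp_leq _ _))// ltnS.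
    by rewrite -[leqRHS]mul1n leq_mul2r -subn1 leq_subLR s2 orbT.
  under eq_bigr do rewrite -PE -mulrA.
  by rewrite -mulr_sumr (divided_difference_poly tinj sP) mulr0.
have := powR_divided_difference_gt0 om tinj => s0.
have E0 := energy_gt0 p0 (sx ord0).
by rewrite leNgt mulr_gt0// exprn_gt0.
Qed.

(** [eta] is chosen before the dimension and the measure, which makes the final bound uniform. The
    left side is a nonnegative square times the energy, the right side is negative. *)
Lemma nonint_arc (R : realType) (p : R) (k : nat) : k%:R < p -> p < k.+1%:R ->
  exists2 eta : R, 0 < eta & forall (n : nat) (mu : probability (usphere R n) R)
    (x : 'I_k.+3 -> usphere R n) (a b : 'I_k.+3 -> R),
  minimizer p mu -> injective x -> (forall i, supp mu (x i)) ->
  (forall i, 0 < a i) -> (forall i, `|b i / a i| < eta) ->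
  (forall i j, udot (x i) (x j) = a i * a j + b i * b j) -> False.
Proof.
move=> kp pk; have [e e0 He] := powR_kernel_double_difference kp pk.
have p0 : 0 < p := le_lt_trans (ler0n _ _) kp.
exists (Num.min e 1); first by rewrite lt_min e0 ltr01.
move=> n mu x a b mumin xinj sx a0 bt xab.
pose t i := b i / a i.
have tinj : injective t := slopes_inj xinj a0 xab.
have te i : `|t i| < e by rewrite (lt_le_trans (bt i))// ge_min lexx.
have t0 i j : 0 <= 1 + t i * t j.
  have t1 l : `|t l| <= 1 by rewrite ltW// (lt_le_trans (bt l))// ge_min lexx orbT.
  have : `|t i * t j| <= 1 by rewrite normrM mulr_ile1.
  by rewrite ler_norml -subr_ge0 opprK addrC => /andP[].
have := minimizer_psd_slopes p0 mumin xinj sx a0 xab (dd_weight t) t0.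
have E0 := energy_gt0 p0 (sx ord0).
move=> /le_lt_trans/(_ (He t tinj te)).
by rewrite ltNge mulr_ge0 ?sqr_ge0 ?ltW.
Qed.

Lemma circle_bound_odd (R : realType) (m : nat) : odd m ->
  circle_bound (m%:R : R) (10 * m)%N.
Proof.
move=> om n _ mu mumin C /circle_coordinates[a [b Cab]].
(* [u] holds on the half-open quadrant a > 0, b >= 0 and on its antipode; the second label of [f]
   tells apart the two quadrants of a pair. *)
pose u x := (0 < a x) && (0 <= b x) || (a x < 0) && (b x <= 0).
pose f x := (u x, if u x then 0 < a x else 0 < b x).
apply: (@card_le_trans _ _ _ `I_(m.+1 * #|{: bool * bool}|)); last first.
  by rewrite card_le_II card_prod card_bool; case: m om {mumin} => // m _; lia.
apply: (@card_le_fibers _ _ _ f) => x xinj sx fx.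
have xC i : C (x i) by have [] := sx i.
have xs i : supp mu (x i) by have [] := sx i.
have xab i j : udot (x i) (x j) = a (x i) * a (x j) + b (x i) * b (x j).
  exact: Cab.
have ab1 i : a (x i) * a (x i) + b (x i) * b (x i) = 1.
  by rewrite -xab udot_self.
have u0 i : u (x i) = u (x ord0) by have [] := fx i ord0.
have v0 i : (if u (x ord0) then 0 < a (x i) else 0 < b (x i)) =
    (if u (x ord0) then 0 < a (x ord0) else 0 < b (x ord0)).
  by have [_] := fx i ord0; rewrite u0.
case: (boolP (u (x ord0))) u0 v0 => _ u0 v0.
- case: (boolP (0 < a (x ord0))) v0 => _ v0.
  + apply: (@odd_arc R n m mu x (a \o x) (b \o x)) => //= i.
    by have := u0 i; rewrite /u v0 /= ltNge (ltW (v0 i)) /= orbF.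
  + have an i : a (x i) < 0.
      by have := u0 i; rewrite /u v0 /= => /andP[].
    apply: (@odd_arc R n m mu x (fun i => - a (x i)) (fun i => - b (x i))) => //.
    * by move=> i; rewrite oppr_gt0.
    * by move=> i; rewrite oppr_ge0; have := u0 i; rewrite /u v0 /= => /andP[].
    * by move=> i j; rewrite xab !mulrNN.
- have u1 i : ~~ u (x i) by rewrite u0.
  case: (boolP (0 < b (x ord0))) v0 => _ v0.
  (* A quarter turn brings this quadrant to a > 0, b >= 0 and preserves inner products. *)
  + apply: (@odd_arc R n m mu x (fun i => b (x i)) (fun i => - a (x i))) => //.
    * move=> i; rewrite oppr_ge0 leNgt; apply: contra (u1 i) => ai.
      by rewrite /u ai (ltW (v0 i)).
    * by move=> i j; rewrite xab mulrNN addrC.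
  + have bn i : b (x i) < 0.
      rewrite ltNge; apply/negP => bi.
      have {bi} bi : b (x i) = 0 by apply/eqP; rewrite eq_le bi andbT leNgt v0.
      have := u1 i; rewrite /u bi lexx !andbT -neq_lt negbK => /eqP ai.
      have := ab1 i; rewrite -ai bi !mulr0 addr0 => /eqP.
      by rewrite eq_sym oner_eq0.
    apply: (@odd_arc R n m mu x (fun i => - b (x i)) (fun i => a (x i))) => //.
    * by move=> i; rewrite oppr_gt0.
    * move=> i; rewrite leNgt; apply: contra (u1 i) => ai.
      by rewrite /u ai (ltW (bn i)) orbT.
    * by move=> i j; rewrite xab mulrNN addrC.
Qed.

(** The square [-1, 1]^2 of coordinates is cut into cells of side [e]. Points of one cell, rotated
    so that the first becomes (1, 0), have slopes below [eta]. *)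
Lemma circle_bound_nonint (R : realType) (p : R) (k : nat) :
  k%:R < p -> p < k.+1%:R ->
  exists2 N : nat, (0 < N)%N & circle_bound p (k.+2 * N)%N.
Proof.
move=> kp pk; have [eta eta0 arc] := nonint_arc kp pk.
(* The bound 1/2 gives [al] above 1/2, and |be| <= 2e then gives slopes of size below 4e <=
   eta/2. *)
pose e := Num.min (1 / 2) (eta / 8).
have e0 : 0 < e by rewrite lt_min !divr_gt0.
have e2 : e <= 1 / 2 by rewrite ge_min lexx.
have e8 : e <= eta / 8 by rewrite ge_min lexx orbT.
(* For |y| <= 1 the quotient (y + 1) / e lies between 0 and 2 / e, so its integer part is at most
   [M]. *)
pose M := Num.truncn (2 / e).
exists #|{: 'I_M.+1 * 'I_M.+1}|; first by rewrite card_prod card_ord.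
move=> n _ mu mumin C /circle_coordinates[a [b Cab]].
pose cell (y : R) : 'I_M.+1 := inord (Num.truncn ((y + 1) / e)).
have cellP y z : `|y| <= 1 -> `|z| <= 1 -> cell y = cell z -> `|y - z| < e.
  have inM w : `|w| <= 1 -> 0 <= (w + 1) / e /\ (Num.truncn ((w + 1) / e) < M.+1)%N.
    rewrite ler_norml => /andP[w1 w2]; split.
      by rewrite divr_ge0 ?(ltW e0)// -lerBlDr sub0r.
    rewrite ltnS; apply: le_truncn; rewrite ler_pM2r ?invr_gt0//; lra.
  move=> /inM[y0 yM] /inM[z0 zM] /(congr1 val) /=; rewrite !inordK// => yz.
  have := truncn_itv y0; have := truncn_itv z0; rewrite yz -natr1.
  move: (_%:R) => q; rewrite !ler_pdivlMr// !ltr_pdivrMr// ltr_norml.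
  by move=> /andP[h1 h2] /andP[h3 h4]; apply/andP; split; lra.
apply: (@card_le_fibers _ _ _ (fun x => (cell (a x), cell (b x)))) => x xinj sx fx.
have xC i : C (x i) by have [] := sx i.
have xs i : supp mu (x i) by have [] := sx i.
have xab i j : udot (x i) (x j) = a (x i) * a (x j) + b (x i) * b (x j).
  exact: Cab.
have ab1 i : a (x i) * a (x i) + b (x i) * b (x i) = 1.
  by rewrite -xab udot_self.
have a1 i : `|a (x i)| <= 1.
  by rewrite ler_norml; have := ab1 i => h; apply/andP; split; nra.
have b1 i : `|b (x i)| <= 1.
  by rewrite ler_norml; have := ab1 i => h; apply/andP; split; nra.
pose a0 := a (x ord0); pose b0 := b (x ord0).
have da i : `|a (x i) - a0| < e.
  exact: (cellP _ _ (a1 i) (a1 ord0) (congr1 fst (fx i ord0))).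
have db i : `|b (x i) - b0| < e.
  exact: (cellP _ _ (b1 i) (b1 ord0) (congr1 snd (fx i ord0))).
(* These are the cosine and sine of the angle from the point [x ord0] to [x i]. *)
pose al i := a0 * a (x i) + b0 * b (x i).
pose be i := a0 * b (x i) - b0 * a (x i).
have al2 i : 1 / 2 < al i.
  have sq (y : R) : `|y| < e -> y ^+ 2 <= 1 / 4.
    move=> ye; rewrite -real_normK ?num_real//.
    rewrite (le_trans (_ : _ <= (1 / 2) ^+ 2))//; last lra.
    by rewrite lerXn2r ?nnegrE// ?divr_ge0// (le_trans (ltW ye)).
  have := sq _ (da i); have := sq _ (db i); have := ab1 i; have := ab1 ord0.
  by rewrite /al -/a0 -/b0; lra.
have be2 i : `|be i| <= 2 * e.
  have -> : be i = a0 * (b (x i) - b0) - b0 * (a (x i) - a0) by rewrite /be; ring.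
  rewrite (le_trans (ler_normB _ _))// !normrM [2 * e]mulr_natl mulr2n lerD//.
    by rewrite -[leRHS]mul1r ler_pM// ?a1// ltW.
  by rewrite -[leRHS]mul1r ler_pM// ?b1// ltW.
apply: (arc n mu x al be) => //.
- by move=> i; rewrite (lt_trans _ (al2 i))// divr_gt0.
- move=> i; have ali : 0 < al i by rewrite (lt_trans _ (al2 i))// divr_gt0.
  rewrite normrM normfV (gtr0_norm ali) ltr_pdivrMr//.
  have := be2 i; have := al2 i; nra.
- move=> i j; rewrite xab -[LHS]mul1r -(ab1 ord0) /al /be /a0 /b0; ring.
Qed.

Theorem theorem4p1 (R : realType) (p : R) (p_gt0 : 0 < p)
    (p_noteven : ~ positive_even p) :
  [/\ exists B : nat, circle_bound p B,
      forall m : nat, odd m -> p = m%:R -> circle_bound p (10 * m)%N,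
      p \isn't a Num.int -> exists delta : R, 0 < delta /\
        circle_bound p ((`|Num.floor p| + 2) * `|Num.ceil (2 * pi / delta)|)%N
    & forall mu : probability (usphere R 1) R,
        minimizer p mu -> finite_set (supp mu)].
Proof.
have odd_case m : odd m -> p = m%:R -> circle_bound p (10 * m)%N.
  by move=> om ->; exact: circle_bound_odd.
have nonint_case : p \isn't a Num.int -> exists delta : R, 0 < delta /\
    circle_bound p ((`|Num.floor p| + 2) * `|Num.ceil (2 * pi / delta)|)%N.
  move=> pint.
  have fl0 : 0 <= Num.floor p by rewrite floor_ge0 ltW.
  have fp : (`|Num.floor p|%N)%:R = (Num.floor p)%:~R :> R.
    by rewrite pmulrn gez0_abs.
  have kp : (`|Num.floor p|%N)%:R < p.
    rewrite fp lt_neqAle floor_le andbT; apply: contra pint => /eqP <-.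
    exact: intr_int.
  have pk : p < (`|Num.floor p|%N).+1%:R.
    by rewrite -natr1 fp (lt_le_trans (floorD1_gt p))// intrD.
  have [N N0 HN] := circle_bound_nonint kp pk.
  have pi20 : 0 < 2 * pi :> R by rewrite mulr_gt0 ?pi_gt0.
  (* With this [delta] the quotient 2 pi / delta is exactly the integer [N], and its ceiling changes
     nothing. *)
  exists (2 * pi / N%:R); split; first by rewrite divr_gt0 ?ltr0n.
  have -> : 2 * pi / (2 * pi / N%:R) = N%:~R :> R.
    by rewrite -pmulrn invf_div mulrC divfK ?(gt_eqF pi20).
  by rewrite intrKceil absz_nat addn2.
have bound : exists B : nat, circle_bound p B.
  have [pint|/nonint_case[delta [_ ?]]] := boolP (p \is a Num.int); last first.
    by exists ((`|Num.floor p| + 2) * `|Num.ceil (2 * pi / delta)|)%N.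
  have /natrP[m pm] : p \is a Num.nat by rewrite natrEint pint ltW.
  exists (10 * m)%N; apply: odd_case => //; apply: contraT => em.
  exfalso; apply: p_noteven; exists m./2.
  have em2 : (2 * m./2 = m)%N by rewrite mul2n even_halfK.
  by rewrite em2; split=> //; move: p_gt0; rewrite pm ltr0n -{1}em2; case: m./2.
split=> // mu mumin; have [B HB] := bound.
(* In dimension 2 the whole sphere is a great circle, cut out by the full space. *)
have gT : great_circle [set: usphere R 1].
  exists fullv; split; first by rewrite dimvf /dim /=.
  by apply/seteqP; split => x _ //=; rewrite memvf.
have := HB 1%N isT mu mumin setT gT; rewrite setIT.
move=> /card_le_finite; apply; exact: finite_II.
Qed.
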